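(* Let $P$ and $Q$ be transition kernels on the same finite labelled state space $S=\{1,\dots,n\}$ with the same labelled action sets $A(s)$ and the same discount factor $\gamma\in(0,1)$. Then $P\equiv_{\mathrm{s}}Q$ if and only if $\mathcal R_P(\pi)=\mathcal R_Q(\pi)$ for every deterministic stationary policy $\pi$.
   Context: $S=\{1,\dots,n\}$ is a finite set of states; each state $s$ has a finite nonempty action set $A(s)$; $\gamma\in(0,1)$ is fixed. A transition kernel $P$ assigns to each $s\in S$, $a\in A(s)$ a row vector $P_{s,a}=P(\cdot\mid s,a)\in\mathbb R^{1\times n}$ with nonnegative entries summing to $1$. A deterministic stationary policy $\pi$ chooses $\pi(s)\in A(s)$ for each $s$; $P^\pi$ is the $n\times n$ matrix whose $s$th row is $P_{s,\pi(s)}$. A state reward is a function $r:S\to\mathbb R$, viewed as a column vector in $\mathbb R^n$. Its optimal value $V_{P,r}^*\in\mathbb R^n$ is the unique vector with $V_{P,r}^*(s)=r(s)+\gamma\max_{a\in A(s)}P_{s,a}V_{P,r}^*$ for all $s$, and $\operatorname{Opt}_{P,r}(s)=\arg\max_{a\in A(s)}\{r(s)+\gamma P_{s,a}V_{P,r}^*\}\subseteq A(s)$. $P\equiv_{\mathrm{s}}Q$ means $\operatorname{Opt}_{P,r}(s)=\operatorname{Opt}_{Q,r}(s)$ for every state reward $r$ and every $s\in S$. For a deterministic stationary policy $\pi$, $$\mathcal R_P(\pi)=\left\{r\in\mathbb R^n:(P_{s,\pi(s)}-P_{s,a})(I-\gamma P^\pi)^{-1}r\ge 0\text{ for every }s\in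 S,\ a\in A(s)\right\}.$$ *)

(* Defs.v *)
From mathcomp Require Import all_boot all_order all_algebra.
From mathcomp Require Import boolp classical_sets reals ring lra.

Set Implicit Arguments.
Unset Strict Implicit.
Unset Printing Implicit Defensive.

Import Order.TTheory GRing.Theory Num.Theory.
Local Open Scope classical_set_scope.
Local Open Scope ring_scope.

(* States are 'I_n, i.e. numbered from 0; state s has action type A s. *)
Record kernel (R : realType) (n : nat) (A : 'I_n -> finType) := Kernel {
  trans :> forall s : 'I_n, A s -> 'rV[R]_n ;
  trans_ge0 : forall s (a : A s) t, 0 <= trans a 0 t ;
  trans_sum1 : forall s (a : A s), \sum_t trans a 0 t = 1
}.

Arguments trans {R n A} k s a.

Definition policy (n : nat) (A : 'I_n -> finType) := forall s : 'I_n, A s.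

Section MDP.
Context {R : realType} {n : nat} {A : 'I_n -> finType}.
Implicit Types (gamma : R) (P Q : kernel R A) (r V W : 'cV[R]_n) (pi : policy A).

(* When A s is nonempty this supremum over a finite set is a maximum, see
   max_next_ub and max_next_attained. *)
Definition max_next P V (s : 'I_n) : R :=
  sup (range (fun a : A s => (P s a *m V) 0 0)).

Definition bellman gamma P r V : Prop :=
  forall s, V s 0 = r s 0 + gamma * max_next P V s.

(* The unique solution of the Bellman equation, see opt_valueP and
   opt_value_unique; the default 0 is irrelevant. *)
Definition opt_value gamma P r : 'cV[R]_n := xget 0 [set V | bellman gamma P r V].

Definition Opt gamma P r s : set (A s) :=
  let V := opt_value gamma P r in
  [set a | forall b : A s,
     r s 0 + gamma * (P s b *m V) 0 0 <= r s 0 + gamma * (P s a *m V) 0 0].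

Arguments Opt gamma P r s : clear implicits.

Definition state_equiv gamma P Q : Prop :=
  forall r s, Opt gamma P r s = Opt gamma Q r s.

Definition policy_mx P pi : 'M[R]_n := \matrix_s P s (pi s).

(* For 0 < gamma < 1 the matrix 1 - gamma P^pi is strictly diagonally dominant,
   so invmx is its actual inverse. *)
Definition reward_region gamma P pi : set 'cV[R]_n :=
  [set r | forall s (a : A s),
     0 <= ((P s (pi s) - P s a) *m invmx (1%:M - gamma *: policy_mx P pi) *m r) 0 0].

Section WellPosed.
Hypothesis A_gt0 : forall s, (0 < #|A s|)%N.

Lemma max_next_attained P V s : exists a, max_next P V s = (P s a *m V) 0 0.
Proof.
have /card_gt0P[a0 _] := A_gt0 s.
pose f (a : A s) := (P s a *m V) 0 0.
case: (@arg_maxP _ R (A s) a0 predT f) => // a _ amax.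
have ub : ubound (range f) (f a) by move=> _ [b _ <-]; exact: amax.
exists a; apply/eqP; rewrite eq_le; apply/andP; split.
  by apply: ge_sup => //; exists (f a), a.
by apply: ub_le_sup; [exists (f a) | exists a].
Qed.

Lemma max_next_ub P V s a : (P s a *m V) 0 0 <= max_next P V s.
Proof.
have /card_gt0P[a0 _] := A_gt0 s.
pose f (a : A s) := (P s a *m V) 0 0.
case: (@arg_maxP _ R (A s) a0 predT f) => // b _ bmax.
apply: ub_le_sup; last by exists a.
by exists (f b) => _ [c _ <-]; exact: bmax.
Qed.

Lemma kernel_le P s (a : A s) V W d : (forall t, V t 0 <= W t 0 + d) ->
  (P s a *m V) 0 0 <= (P s a *m W) 0 0 + d.
Proof.
move=> VW; rewrite !mxE -[d]mul1r -(trans_sum1 P a) mulr_suml -big_split /=.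
by apply: ler_sum => t _; rewrite -mulrDr; apply: ler_wpM2l (VW t); exact: trans_ge0.
Qed.

Lemma max_next_le P V W d s : (forall t, V t 0 <= W t 0 + d) ->
  max_next P V s <= max_next P W s + d.
Proof.
move=> VW; have [a ->] := max_next_attained P V s.
by apply: le_trans (kernel_le P a VW) _; rewrite lerD2r max_next_ub.
Qed.

Lemma bellman_le gamma P r V W : 0 < gamma < 1 ->
  (forall s, V s 0 <= r s 0 + gamma * max_next P V s) ->
  (forall s, r s 0 + gamma * max_next P W s <= W s 0) ->
  forall s, V s 0 <= W s 0.
Proof.
move=> /andP[g0 g1] HV HW s.
case: (@arg_maxP _ R 'I_n s predT (fun t => V t 0 - W t 0)) => // t _ tmax.
have VW u : V u 0 <= W u 0 + (V t 0 - W t 0).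
  by have /= := tmax u isT; lra.
have := ler_wpM2l (ltW g0) (max_next_le P t VW).
have := HV t; have := HW t; have := VW s; nra.
Qed.

Lemma opt_value_unique gamma P r V W : 0 < gamma < 1 ->
  bellman gamma P r V -> bellman gamma P r W -> V = W.
Proof.
move=> hg HV HW; apply/matrixP => s j; rewrite (ord1 j).
by apply/eqP; rewrite eq_le; apply/andP; split;
  apply: (bellman_le (r := r) (P := P) hg) => t; rewrite -?HV -?HW.
Qed.

Lemma max_next_const P c s : max_next P (const_mx c) s = c.
Proof.
have [a ->] := max_next_attained P (const_mx c) s; rewrite mxE.
under eq_bigr do rewrite [X in _ * X]mxE.
by rewrite -mulr_suml trans_sum1 mul1r.
Qed.

Lemma opt_value_exists gamma P r : 0 < gamma < 1 -> exists V, bellman gamma P r V.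
Proof.
move=> hg; have /andP[g0 g1] := hg.
pose T V : 'cV[R]_n := \col_s (r s 0 + gamma * max_next P V s).
pose M := \sum_s `|r s 0|; pose C := M / (1 - gamma).
have rM s : `|r s 0| <= M.
  by rewrite /M (bigD1 s) //= lerDl sumr_ge0.
have CM : C = M + gamma * C by rewrite /C; field; rewrite subr_eq0 gt_eqF.
pose E s := [set V s 0 | V in [set V : 'cV[R]_n | forall t, V t 0 <= T V t 0]].
have Eub (V : 'cV[R]_n) s : (forall t, V t 0 <= T V t 0) -> V s 0 <= C.
  move=> HV; have <- : (const_mx C : 'cV[R]_n) s 0 = C by rewrite mxE.
  apply: (bellman_le (r := r) (P := P) hg) => t; first by have := HV t; rewrite mxE.
  by rewrite max_next_const mxE; have := ler_norm (r t 0); have := rM t; lra.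
have En s : E s !=set0.
  exists (- C), (const_mx (- C)); rewrite ?mxE // => t; rewrite !mxE max_next_const.
  by have := rM t; rewrite ler_norml => /andP[]; lra.
have Es s : has_ubound (E s) by exists C => _ [V HV <-]; exact: Eub.
pose V : 'cV[R]_n := \col_s sup (E s).
have Tmono (V1 V2 : 'cV[R]_n) : (forall t, V1 t 0 <= V2 t 0) -> forall t, T V1 t 0 <= T V2 t 0.
  move=> H t; rewrite !mxE lerD2l ler_pM2l // -[leRHS]addr0.
  by apply: max_next_le => u; rewrite addr0.
have VT s : V s 0 <= T V s 0.
  rewrite mxE; apply: ge_sup => // _ [W HW <-]; apply: le_trans (HW s) _.
  by apply: Tmono => t; rewrite mxE; apply: ub_le_sup => //; exists W.
exists V => s; transitivity (T V s 0); last by rewrite mxE.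
apply/eqP; rewrite eq_le VT /= [leRHS]mxE; apply: ub_le_sup => //.
by exists (T V) => // t; exact: Tmono.
Qed.

Lemma opt_valueP gamma P r : 0 < gamma < 1 -> bellman gamma P r (opt_value gamma P r).
Proof. by move=> hg; have := opt_value_exists P r hg; exact: (@xgetPex _ 0 [set V | bellman gamma P r V]). Qed.

End WellPosed.
End MDP.

(* Main.v *)
(** The region of [pi] consists of the rewards for which every action of [pi] is
    optimal: its inequalities say exactly that the value [V] of [pi] solves the
    Bellman equation, so that [V] is the optimal value, and conversely a greedy
    policy has the optimal value as its value.  The regions and the optimal action
    sets therefore determine each other, as the optimal policies of a given reward
    form the product over the states of the nonempty optimal action sets. *)
Require Import Defs.
From mathcomp Require Import all_boot all_order all_algebra.
From mathcomp Require Import boolp classical_sets reals.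
Import Order.TTheory GRing.Theory Num.Theory.
Local Open Scope ring_scope.

Section PolicyValue.
Context {R : realType} {n : nat} {A : 'I_n -> finType}.
Hypothesis A_gt0 : forall s : 'I_n, (0 < #|A s|)%N.
Variable gamma : R.
Hypothesis gamma01 : 0 < gamma < 1.
Implicit Types (P Q : kernel R A) (pi : policy A) (r V : 'cV[R]_n).

(* [P^pi] seen as a kernel with one action per state, so that results on the
   Bellman equation apply to the evaluation of [pi]. *)
Definition policy_kernel P pi : kernel R (fun _ : 'I_n => unit) :=
  @Kernel R n (fun _ => unit) (fun s _ => P s (pi s))
    (fun s _ => trans_ge0 P (pi s)) (fun s _ => trans_sum1 P (pi s)).

Lemma max_next_policy_kernel P pi V s :
  max_next (policy_kernel P pi) V s = (P s (pi s) *m V) 0 0.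
Proof.
have unit_gt0 (t : 'I_n) : (0 < #|{: unit}|)%N by rewrite card_unit.
by have [a ->] := max_next_attained unit_gt0 (policy_kernel P pi) V s.
Qed.

Lemma policy_mx_mulE P pi V s : (policy_mx P pi *m V) s 0 = (P s (pi s) *m V) 0 0.
Proof. by rewrite !mxE; apply: eq_bigr => t _; rewrite mxE. Qed.

Lemma policy_eqP P pi r V :
  (1%:M - gamma *: policy_mx P pi) *m V = r <->
  forall s, V s 0 = r s 0 + gamma * (P s (pi s) *m V) 0 0.
Proof.
rewrite mulmxBl mul1mx -scalemxAl; split=> [<- s | VE].
  by rewrite -policy_mx_mulE !mxE subrK.
apply/matrixP => s j; rewrite (ord1 j) mxE VE -policy_mx_mulE.
by rewrite [X in _ + X]mxE [X in _ - X]mxE addrK.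
Qed.

(** A vector killed by the matrix is the value of [pi] for the zero reward, as is the zero vector;
    uniqueness for the Bellman equation of [policy_kernel P pi] makes them equal. *)
Lemma policy_mx_unit P pi : 1%:M - gamma *: policy_mx P pi \in unitmx.
Proof.
(* [det0P] provides a null row vector, so transposing first gives a null column vector of [M]. *)
set M := (X in X \in _); rewrite -unitmx_tr unitmxE unitfE.
apply/negP => /det0P[v /negP v0 vM]; apply: v0.
have sol W : M *m W = 0 -> bellman gamma (policy_kernel P pi) 0 W.
  by move/policy_eqP => WE s; rewrite max_next_policy_kernel -WE.
rewrite -(inj_eq trmx_inj) trmx0; apply/eqP.
apply: (@opt_value_unique _ _ _ _ gamma (policy_kernel P pi) 0) => //.
- by move=> t; rewrite card_unit.
- by apply: sol; rewrite -[M]trmxK -trmx_mul vM trmx0.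
- by apply: sol; rewrite mulmx0.
Qed.

Lemma policy_valueP P pi r V :
  V = invmx (1%:M - gamma *: policy_mx P pi) *m r <->
  forall s, V s 0 = r s 0 + gamma * (P s (pi s) *m V) 0 0.
Proof.
rewrite -policy_eqP; have U := policy_mx_unit P pi.
by split=> [-> | <-]; rewrite ?mulKVmx ?mulKmx.
Qed.

Lemma max_nextE P V s a :
  max_next P V s = (P s a *m V) 0 0 <->
  forall b, (P s b *m V) 0 0 <= (P s a *m V) 0 0.
Proof.
split=> [<- b | amax]; first exact: max_next_ub.
apply/eqP; rewrite eq_le max_next_ub // andbT.
by have [b ->] := max_next_attained A_gt0 P V s.
Qed.

Lemma OptE P r s (a : A s) :
  Opt gamma P r a <->
  max_next P (opt_value gamma P r) s = (P s a *m opt_value gamma P r) 0 0.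
Proof.
have /andP[g0 _] := gamma01.
by rewrite max_nextE; split=> H b; have := H b; rewrite lerD2l ler_pM2l.
Qed.

Lemma Opt_nonempty P r s : exists a : A s, Opt gamma P r a.
Proof.
have [a aE] := max_next_attained A_gt0 P (opt_value gamma P r) s.
by exists a; apply/OptE.
Qed.

Lemma reward_regionE P pi r :
  reward_region gamma P pi r <-> forall s, Opt gamma P r (pi s).
Proof.
have optP := opt_valueP A_gt0 P r gamma01.
pose V := invmx (1%:M - gamma *: policy_mx P pi) *m r.
have regionE : reward_region gamma P pi r <->
    forall s, max_next P V s = (P s (pi s) *m V) 0 0.
  split=> [H s | H s a].
    apply/max_nextE => a; have := H s a.
    by rewrite -mulmxA mulmxBl mxE [X in _ + X]mxE subr_ge0.
  rewrite -mulmxA mulmxBl mxE [X in _ + X]mxE subr_ge0.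
  by have /max_nextE := H s.
have VE := (policy_valueP P pi r V).1 erefl.
rewrite regionE; split=> [H s | H].
  have VB : bellman gamma P r V by move=> t; rewrite H -VE.
  by apply/OptE; rewrite (opt_value_unique A_gt0 gamma01 optP VB).
(* Each [pi s] attains the maximum, so the Bellman equation of the optimal value becomes the
   evaluation equation of [pi], solved only by [V]. *)
have -> : V = opt_value gamma P r.
  by symmetry; apply/policy_valueP => s; have /OptE <- := H s; exact: optP.
by move=> s; apply/OptE.
Qed.

Lemma Opt_sub P Q r s :
  (forall pi, reward_region gamma P pi = reward_region gamma Q pi) ->
  (@Opt _ _ _ gamma P r s `<=` @Opt _ _ _ gamma Q r s)%classic.
Proof.
move=> PQ a aP.
(* Playing [a] at [s] and a chosen [P]-optimal action elsewhere puts [r] in the region of [pi] for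
   [P], hence for [Q]. *)
pose pi : policy A := dfwith (fun t => projT1 (cid (Opt_nonempty P r t))) a.
have : reward_region gamma Q pi r.
  rewrite -PQ; apply/reward_regionE => t; rewrite /pi.
  by case: dfwithP => // u _; exact: projT2.
by move/reward_regionE/(_ s); rewrite /pi dfwith_in.
Qed.

End PolicyValue.

Theorem theorem5p2 (R : realType) (n : nat) (A : 'I_n -> finType)
    (hA : forall s : 'I_n, (0 < #|A s|)%N)
    (gamma : R) (hgamma : 0 < gamma < 1) (P Q : kernel R A) :
  state_equiv gamma P Q <->
  (forall pi : policy A, reward_region gamma P pi = reward_region gamma Q pi).
Proof.
split=> [PQ pi | PQ r s].
  apply/seteqP; split=> r /(reward_regionE hA _ hgamma) H;
    apply/(reward_regionE hA _ hgamma) => s; first by rewrite -PQ.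
  by rewrite PQ.
by apply/seteqP; split; apply: (Opt_sub hA _ hgamma).
Qed.
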